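(* Let $\mathcal G$ be a semifilter on $\omega$ that is a $G_\delta$ subset of $2^\omega$. If $\mathfrak d=\mathfrak c$, then there is an ultrafilter on $\mathcal G$ that is a $P$-filter. Moreover: (1) if $\mathfrak d=\mathfrak c$, then every filter on $\mathcal G$ that is generated by fewer than $\mathfrak c$ sets is included in some ultrafilter on $\mathcal G$ that is a $P$-filter; (2) every ultrafilter on $\mathcal G$ that is generated by fewer than $\mathfrak d$ sets is a $P$-filter.
   Context: For $A,B\subseteq\omega$, $A\subseteq^* B$ means $A\setminus B$ is finite. A semifilter on $\omega$ is a set $\mathcal S\subseteq\mathcal P(\omega)$ with $\emptyset\neq\mathcal S\neq\mathcal P(\omega)$ closed upwards under $\subseteq^*$; subsets of $\omega$ are identified with points of $2^\omega$ (product topology). A filter on $\mathcal S$ is a nonempty $\mathcal F\subseteq\mathcal S$ such that $A\in\mathcal F$ and $A\subseteq^* B$ imply $B\in\mathcal F$, and $A,B\in\mathcal F$ imply $A\cap B\in\mathcal F$. An ultrafilter on $\mathcal S$ is a maximal (under inclusion) filter on $\mathcal S$. A filter $\mathcal F$ is generated by a family $\mathcal B\subseteq\mathcal F$ if $\mathcal F=\{A: B\subseteq^* A\text{ for some }B\in\mathcal B\}$. $\omega^*$ is the space of free ultrafilters on $\omega$ (the Stone–Čech remainder of $\omega$) with basic open sets $A^*=\{p\in\omega^*:A\in p\}$; the Stone dual of a filter $\mathcal F$ is $\hat{\mathcal F}=\bigcap_{A\in\mathcal F}A^*$. A set $X\subseteq\omega^*$ is a $P$-set if for every sequence of open sets $U_n\supseteq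 X$, $X$ lies in the interior of $\bigcap_n U_n$. A filter $\mathcal F$ is a $P$-filter if $\hat{\mathcal F}$ is a $P$-set (equivalently, every countable subfamily of $\mathcal F$ has a lower bound under $\subseteq^*$ in $\mathcal F$). $\mathfrak d$ is the dominating number and $\mathfrak c=2^{\aleph_0}$. *)

(* Defs.v *)
From HB Require Import structures.
From mathcomp Require Import all_boot all_order all_algebra.
From mathcomp Require Import all_classical all_reals topology cantor borel_hierarchy.

Set Implicit Arguments.
Unset Strict Implicit.
Unset Printing Implicit Defensive.

Local Open Scope classical_set_scope.
Local Open Scope card_scope.

Definition almost_subset (A B : set nat) : Prop := finite_set (A `\` B).
Notation "A '`<=*`' B" := (almost_subset A B) (at level 70, no associativity).

Definition almost_up_closed (S : set (set nat)) : Prop :=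
  forall A B, S A -> A `<=*` B -> S B.

Definition semifilter (S : set (set nat)) : Prop :=
  [/\ S !=set0, S <> setT & almost_up_closed S].

(* Points of 2^omega are characteristic functions of subsets of omega. *)
Definition in_cantor (S : set (set nat)) : set cantor_space :=
  [set x : cantor_space | S [set n | x n]].

Definition semifilter_filter (S F : set (set nat)) : Prop :=
  [/\ F !=set0, F `<=` S, almost_up_closed F &
      forall A B, F A -> F B -> F (A `&` B)].

Definition semifilter_ultrafilter (S F : set (set nat)) : Prop :=
  semifilter_filter S F /\ forall H, semifilter_filter S H -> F `<=` H -> H = F.

Definition generated_by (F B : set (set nat)) : Prop :=
  B `<=` F /\ F = [set A | exists2 C, B C & C `<=*` A].

(* The remainder omega^* of the Stone-Cech compactification of omega. *)
Record omega_star := OmegaStar {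
  star_sets :> set (set nat);
  star_ultra : UltraFilter star_sets;
  star_free : \bigcap_(A in star_sets) A = set0 }.

HB.instance Definition _ := gen_eqMixin omega_star.
HB.instance Definition _ := gen_choiceMixin omega_star.

Definition star (A : set nat) : set omega_star :=
  [set p : omega_star | star_sets p A].

Lemma star_cover : \bigcup_(A in [set: set nat]) star A = setT.
Proof.
apply/seteqP; split => // p _; exists setT => //.
have pF := star_ultra p; exact: (@filterT _ (star_sets p) _).
Qed.

Lemma star_join (A B : set nat) (p : omega_star) :
  [set: set nat] A -> [set: set nat] B -> star A p -> star B p ->
  exists C, [/\ [set: set nat] C, star C p & star C `<=` star A `&` star B].
Proof.
move=> _ _ pA pB; exists (A `&` B); split => //.
  have pF := star_ultra p; exact: filterI.
move=> q qAB; have qF := star_ultra q.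
by split; apply: filterS qAB => n [].
Qed.

HB.instance Definition _ := isBaseTopological.Build omega_star
  star_cover star_join.

Definition stone_dual (F : set (set nat)) : set omega_star :=
  \bigcap_(A in F) star A.

Definition P_set (T : topologicalType) (X : set T) : Prop :=
  forall U : nat -> set T, (forall n, open (U n)) -> (forall n, X `<=` U n) ->
    X `<=` interior (\bigcap_n U n).

Definition P_filter (F : set (set nat)) : Prop := P_set (stone_dual F).

Definition card_lt (T U : Type) (A : set T) (B : set U) : Prop :=
  A #<= B /\ ~ (B #<= A).

Definition dominating (D : set (nat -> nat)) : Prop :=
  forall f : nat -> nat, exists2 g, D g & finite_set [set n | ~ (f n <= g n)%N].

(* The dominating number is the least cardinality of a dominating family.
   Cardinals are compared through representing sets: [card_eq_d A] says
   |A| = d, and [card_lt_d A] says |A| < d. *)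
Definition card_eq_d (T : Type) (A : set T) : Prop :=
  (exists2 D, dominating D & D #= A) /\ forall D, dominating D -> A #<= D.

Definition card_lt_d (T : Type) (A : set T) : Prop :=
  forall D, dominating D -> card_lt A D.

Definition card_lt_c (T : Type) (A : set T) : Prop :=
  card_lt A [set: set nat].

Definition d_eq_c : Prop := card_eq_d [set: set nat].

(* Main.v *)
(** Let [G] be the intersection of the open sets [U_n], and suppose that a
    decreasing sequence [A_n] and the members [C] of a family [B] satisfy
    [G (C `&` A_n)]. As [G] is upward closed, compactness of the Cantor space
    gives functions [f_C] such that every superset of [C `&` A_n] cut at
    [f_C n] is in the first [n] sets [U_m]. When [|B| < d], some [g] is not
    dominated by any [f_C]; then the union of the sets [A_n] cut at [g n] is a
    pseudo-intersection of the [A_n] whose trace on every [C] is in [G]. This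
    gives (2) at once. For (1), all sequences of subsets of [nat] are listed
    along a well-order of type [c]; at each stage a pseudo-intersection of the
    current sequence is added if that sequence is compatible with what has
    been chosen so far. Testing compatibility, rather than membership, means
    that each sequence is treated only once, so no cofinality argument is
    needed, and constant sequences take care of maximality. *)

Require Import Defs.
From mathcomp Require Import all_boot all_order all_algebra.
From mathcomp Require Import all_classical all_reals topology cantor borel_hierarchy.
From mathcomp Require Import wochoice.

Set Implicit Arguments.
Unset Strict Implicit.
Unset Printing Implicit Defensive.

Local Open Scope classical_set_scope.
Local Open Scope card_scope.

(** * Cardinal comparison of types *)

Definition embeds (T U : Type) : Prop := exists f : T -> U, injective f.

Lemma sval_inj T (P : T -> Prop) : injective (@sval T P).
Proof.
move=> [x px] [y py] /= xy; move: py; rewrite -xy => py.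
by rewrite (Prop_irrelevance px py).
Qed.

Lemma embeds_refl T : embeds T T.
Proof. by exists id. Qed.

Lemma embeds_trans U T V : embeds T U -> embeds U V -> embeds T V.
Proof. by move=> [f fI] [g gI]; exists (g \o f); exact: inj_comp. Qed.

Lemma embeds_rel T U (R : T -> U -> Prop) :
  (forall x, exists y, R x y) -> (forall x x' y, R x y -> R x' y -> x = x') ->
  embeds T U.
Proof.
move=> /choice[f fR] RI; exists f => x x' xx'.
by apply: (RI _ _ (f x)); rewrite // xx'.
Qed.

(** Zorn's lemma for graphs of partial injections: if a maximal graph missed a point on each side,
    the pair of missed points could be added. *)
Lemma embeds_total T U : embeds T U \/ embeds U T.
Proof.
pose P := [set R : set (T * U) |
  (forall x y y', R (x, y) -> R (x, y') -> y = y') /\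
  (forall x x' y, R (x, y) -> R (x', y) -> x = x')].
have [F FP Ftot|R [[Rf RI] Rmax]] := @Zorn_bigcup _ P.
  have pair_in p q (S := \bigcup_(X in F) X) : S p -> S q ->
      exists X, [/\ P X, X p & X q].
    move=> [X FX Xp] [Y FY Yq].
    by have [XY|YX] := Ftot _ _ FX FY; [exists Y|exists X]; split=> //;
      [exact: FP|exact: XY|exact: FP|exact: YX].
  by split=> [x y y'|x x' y] /pair_in/[apply] -[X [[Xf XI] ]]; eauto.
have [|/existsNP[x /forallNP xR]] := pselect (forall x, exists y, R (x, y)).
  by left; apply: (@embeds_rel _ _ (fun x y => R (x, y))).
have [|/existsNP[y /forallNP yR]] := pselect (forall y, exists x, R (x, y)).
  move=> h; right; apply: (@embeds_rel _ _ (fun y x => R (x, y))) => //.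
  by move=> ? ? ?; exact: Rf.
exfalso; apply: (Rmax (R `|` [set (x, y)])).
  split; first by left.
  by move=> /(_ (x, y)) /(_ (or_intror erefl)); exact: xR.
split=> [a b b'|a a' b] [] h [] h'; move: h h'.
- exact: Rf.
- by move=> h [ax _]; move: h; rewrite ax => /xR.
- by move=> [ax _] h; move: h; rewrite ax => /xR.
- by move=> [_ ->] [_ ->].
- exact: RI.
- by move=> h [_ bx]; move: h; rewrite bx => /yR.
- by move=> [_ bx] h; move: h; rewrite bx => /yR.
- by move=> [-> _] [-> _].
Qed.

(** Hessenberg's argument. Zorn's lemma gives a maximal injection from a square [X * X] into [X],
    with [X] infinite; the rest of [T] then embeds in [X], since otherwise the injection would
    extend. *)
Lemma embeds_square T : embeds nat T -> embeds (T * T) T.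
Proof.
move=> [c cI].
pose dom (R : set (T * T * T)) x := exists z, R (x, x, z).
pose P := [set R : set (T * T * T) |
  [/\ (forall p z z', R (p, z) -> R (p, z') -> z = z'),
      (forall p p' z, R (p, z) -> R (p', z) -> p = p'),
      (forall x y, dom R x -> dom R y -> exists z, R (x, y, z)) &
      (forall x y z, R (x, y, z) -> [/\ dom R x, dom R y & dom R z])]].
pose R0 := range (fun p : nat * nat => (c p.1, c p.2, c (choice.pickle p))).
have cdom n : dom R0 (c n) by exists (c (choice.pickle (n, n))), (n, n).
have P0 : P R0.
  split.
  - move=> p z z' [[a b] _ [<- <-]] [[a' b'] _ [/cI -> /cI ->]] //.
  - move=> p p' z [[a b] _ [<- <-]] [[a' b'] _ [<-]] /cI.
    by move/(pcan_inj choice.pickleK) => [-> ->].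
  - move=> x y [_ [[a b] _ [<- _ _]]] [_ [[a' b'] _ [<- _ _]]].
    by exists (c (choice.pickle (a, a'))), (a, a').
  - by move=> x y z [[a b] _ [<- <- <-]]; split; exact: cdom.
(* The union with [R0] covers the empty chain and keeps the domain infinite. *)
have [F FP Ftot|R0' [PR Rmax]] := @Zorn_bigcup _ [set R | P (R `|` R0)].
  set S := \bigcup_(X in F) X.
  have pair_in p q : (S `|` R0) p -> (S `|` R0) q ->
      exists X, [/\ P X, X `<=` S `|` R0, X p & X q].
    have sub X : F X -> X `|` R0 `<=` S `|` R0.
      by move=> FX x [Xx|]; [left; exists X|right].
    move=> [[X FX Xp]|R0p] [[Y FY Yq]|R0q]; last first.
    - by exists R0; split=> // x; right.
    - by exists (Y `|` R0); split; [exact: FP|exact: sub|right|left].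
    - by exists (X `|` R0); split; [exact: FP|exact: sub|left|right].
    have [XY|YX] := Ftot _ _ FX FY.
      by exists (Y `|` R0); split; [exact: FP|exact: sub|left; exact: XY|left].
    by exists (X `|` R0); split; [exact: FP|exact: sub|left|left; exact: YX].
  split.
  - by move=> p z z' /pair_in/[apply] -[X [[Xf _ _ _] _]]; exact: Xf.
  - by move=> p p' z /pair_in/[apply] -[X [[_ XI _ _] _]]; exact: XI.
  - move=> x y [z xz] [z' yz'].
    have [X [[_ _ Xd _] XS Xx Xy]] := pair_in _ _ xz yz'.
    have [||w Xw] := Xd x y; [by exists z|by exists z'|].
    by exists w; exact: XS.
  - move=> x y z xyz; have [X [[_ _ _ Xd] XS Xx _]] := pair_in _ _ xyz xyz.
    have [[u Xu] [v Xv] [w Xw]] := Xd _ _ _ Xx.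
    by split; [exists u|exists v|exists w]; exact: XS.
set R := R0' `|` R0 in PR.
have {}Rmax R' : R `<` R' -> ~ P R'.
  move=> RR' PR'; apply: (Rmax R'); last first.
    rewrite /=; suff -> : R' `|` R0 = R' by [].
    by apply/seteqP; split=> [x [//|h]|x]; [apply: (properW RR'); right|left].
  split; first by move=> x h; apply: (properW RR'); left.
  by move=> R'R0'; apply: RR'.2 => x /R'R0'; left.
have [Rf RI Rd Rdom] := PR.
pose X := {x | dom R x}.
have cX n : dom R (c n) by have [z] := cdom n; exists z; right.
pose n_ n : X := exist _ (c n) (cX n).
have n_I : injective n_ by move=> m n /(congr1 sval) /cI.
have /choice[f fR] (p : X * X) : exists z : X, R (sval p.1, sval p.2, sval z).
  have [z h] := Rd _ _ (svalP p.1) (svalP p.2).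
  by have [_ _ zX] := Rdom _ _ _ h; exists (exist _ z zX).
have XI (x y : X) : sval x = sval y -> x = y by move=> ?; exact: sval_inj.
have fI : injective f.
  move=> [a b] [a' b'] e; have := fR (a, b); rewrite e => /RI/(_ (fR (a', b'))).
  by move=> [/XI -> /XI ->].
(* In the first case [f (n_ 0, _)] and [f (n_ 1, _)] give two disjoint copies of [X] inside [X], one
   for [X] and one for its complement, so [T] embeds in [X]. *)
have [[k kI]|[k kI]] := embeds_total {x | ~ dom R x} X.
  suff /choice[j jP] : forall t, exists x : X,
      (exists y : X, sval y = t /\ x = f (n_ 0, y)) \/
      (exists y, sval y = t /\ x = f (n_ 1, k y)).
    have jI : injective j.
      move=> s t; case: (jP s) => -[y [<- ->]]; case: (jP t) => -[z [<- ->]].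
      - by move=> /fI[->].
      - by move=> /fI[/cI].
      - by move=> /fI[/cI].
      - by move=> /fI[/kI ->].
    exists (fun p => sval (f (j p.1, j p.2))) => -[a b] [a' b'] /= /XI /fI.
    by move=> [/jI -> /jI ->].
  move=> t; have [h|h] := pselect (dom R t).
    by exists (f (n_ 0, exist _ t h)); left; exists (exist _ t h).
  by exists (f (n_ 1, k (exist _ t h))); right; exists (exist _ t h).
exfalso.
(* The domain [X] of [R] is enlarged by its disjoint copy [k @` X]; the new
   pairs are coded inside that copy. *)
pose e (t : bool) (x : X) := if t then sval (k x) else sval x.
have kX x : ~ dom R (sval (k x)) by exact: (svalP (k x)).
have kXI x y : sval (k x) = sval (k y) -> x = y by move=> ?; exact/kI/sval_inj.
have eI t u x y : e t x = e u y -> t = u /\ x = y.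
  case: t; case: u => /=.
  - by move=> /kXI.
  - by move=> h; have := svalP y; rewrite -h => /kX.
  - by move=> h; have := svalP x; rewrite h => /kX.
  - by move=> /XI.
(* The number [t + u.*2] separates the blocks of the enlarged square; [N] omits block [0], the old
   square. *)
pose code t u x y := e true (f (n_ (t + u.*2), f (x, y))).
pose N : set (T * T * T) := [set q | exists t u x y,
  t || u /\ q = (e t x, e u y, code t u x y)].
pose R' := R `|` N.
have kN : exists q, N q /\ ~ R q.
  exists (e true (n_ 0), e true (n_ 0), code true true (n_ 0) (n_ 0)).
  split; first by exists true, true, (n_ 0), (n_ 0).
  by move=> /Rdom[/kX].
have domR' t x : dom R' (e t x).
  case: t; first by exists (code true true x x); right; exists true, true, x, x.
  by have [z] := svalP x; exists z; left.
have NR p z z' : N (p, z) -> ~ R (p, z').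
  move=> [t [u [x [y [tu [-> _]]]]]] /Rdom[].
  by case: t tu => /= [_ /kX//|]; case: u => //= _ _ /kX.
have NR' p p' z : N (p, z) -> ~ R (p', z).
  by move: p' => [a b] [t [u [x [y [tu [_ ->]]]]]] /Rdom[_ _ /kX].
have dom'E x : dom R' x -> exists t y, x = e t y.
  move=> [z [h|[t [u [a [b [_ [-> _ _]]]]]]]]; last by exists t, a.
  by have [xX _ _] := Rdom _ _ _ h; exists false, (exist _ x xX).
apply: (Rmax R').
  split; first by left.
  by have [q [Nq Rq]] := kN => /(_ q) /(_ (or_intror Nq)).
split.
- move=> p z z' [h|h] [h'|h'].
  + exact: Rf h h'.
  + by have := NR _ _ _ h' h.
  + by have := NR _ _ _ h h'.
  + move: h h' => [t [u [x [y [_ [-> ->]]]]]].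
    by move=> [t' [u' [x' [y' [_ [/eI[-> ->] /eI[-> ->] ->]]]]]].
- move=> p p' z [h|h] [h'|h'].
  + exact: RI h h'.
  + by have := NR' _ _ _ h' h.
  + by have := NR' _ _ _ h h'.
  + move: h h' => [t [u [x [y [_ [-> ->]]]]]] [t' [u' [x' [y' [_ [->]]]]]].
    move=> /eI[_ /fI[/cI tu /fI[-> ->]]].
    by move: tu; case: t; case: u; case: t'; case: u'.
- move=> x y /dom'E[t [a ->]] /dom'E[u [b ->]].
  case/boolP : (t || u) => tu; last first.
    by case: t u tu => -[]// _; exists (sval (f (a, b))); left;
      exact: (fR (a, b)).
  by exists (code t u a b); right; exists t, u, a, b.
- move=> x y z [h|[t [u [a [b [_ [-> -> ->]]]]]]]; last by split; exact: domR'.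
  have [hx hy hz] := Rdom _ _ _ h.
  split; [exact: (domR' false (exist _ x hx))|
    exact: (domR' false (exist _ y hy))|exact: (domR' false (exist _ z hz))].
Qed.

(** The length is stored along with the folded code, because folding is sure to be injective only
    among lists of the same length. *)
Lemma embeds_seq T : embeds nat T -> embeds (seq T) T.
Proof.
move=> nT; have [c cI] := nT; have [p pI] := embeds_square nT.
pose enc s := foldr (fun x y => p (x, y)) (c 0) s.
have encI s t : size s = size t -> enc s = enc t -> s = t.
  by elim: s t => [|x s IH] [|y t] //= [st] /pI [-> /(IH _ st) ->].
exists (fun s => p (c (size s), enc s)) => s t /pI[/cI st].
exact: encI.
Qed.

Lemma embeds_sum S T : embeds nat T -> embeds S T -> embeds (S + T) T.
Proof.
move=> nT [k kI]; have [c cI] := nT; have [p pI] := embeds_square nT.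
exists (fun x => match x with inl s => p (c 0, k s) | inr t => p (c 1, t) end).
by move=> [s|s] [t|t] /pI [] => [/kI->|/cI|/cI|->].
Qed.

Lemma cantor_nat : ~ embeds (set nat) nat.
Proof.
move=> [f fI]; pose D := [set n | exists X, f X = n /\ ~ X n].
have nD : ~ D (f D).
  by move=> [X [/fI XD]]; rewrite XD => nX; apply: (nX); exists D.
by apply: (nD); exists D.
Qed.

Lemma not_embeds_sum C S T : embeds nat S -> ~ embeds C S -> ~ embeds C T ->
  ~ embeds C (S + T).
Proof.
move=> nS CS CT CST; have [ST|TS] := embeds_total S T.
  by apply/CT/(embeds_trans CST)/embeds_sum => //; exact: embeds_trans ST.
apply/CS/(embeds_trans CST)/(@embeds_trans (T + S)%type); last exact: embeds_sum.
exists (fun x => match x with inl s => inr s | inr t => inl t end).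
by move=> [s|s] [t|t] // [->].
Qed.

Lemma card_le_embeds T U (A : set T) (B : set U) : A #<= B -> embeds A B.
Proof. by move=> /card_leP[f]; exists f => x y; apply: inj; rewrite inE. Qed.

(** [io_segment] makes the order type the initial ordinal of [T]: each proper segment has fewer
    elements than [T]. *)
Record initial_order (T : Type) (lt : T -> T -> Prop) := InitialOrder {
  io_wf : well_founded lt;
  io_trans : forall x y z, lt x y -> lt y z -> lt x z;
  io_total : forall x y, [\/ lt x y, x = y | lt y x];
  io_segment : forall x, ~ embeds T {y | lt y x} }.

(** Let [x] be least in a well-order such that [T] embeds below [x]. The order pulled back along
    that embedding has only small segments, by minimality of [x]. Without such an [x], the
    well-order itself will do. *)
Lemma initial_order_exists (T : eqType) : exists lt, @initial_order T lt.
Proof.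
have [R Rwo] := well_ordering_principle T.
have Rmin (A : set T) : A !=set0 -> exists2 z, A z & forall x, A x -> R z x.
  move=> [a Aa]; have [|z [[zA zm] _]] := Rwo (mem A).
    by exists a; rewrite inE.
  by exists z; [rewrite inE in zA|move=> x Ax; apply: zm; rewrite inE].
have Rtot x y : R x y \/ R y x.
  have [|z [<-|<-] h] := Rmin [set x; y]; first by exists x; left.
    by left; apply: h; right.
  by right; apply: h; left.
have Rxx x : R x x by have [] := Rtot x x.
have Ranti x y : R x y -> R y x -> x = y.
  move=> xy yx; have [|z [_ zu]] := Rwo (mem [set x; y]).
    by exists x; rewrite inE; left.
  by rewrite -(zu x) ?(zu y)//; split; rewrite ?inE /=; auto;
    move=> w; rewrite inE => -[->|->].
have Rtr x y z : R x y -> R y z -> R x z.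
  move=> xy yz.
  have [|w [[->|->]|->] h] := Rmin [set x; y; z]; first by exists x; left; left.
  - by apply: h; right.
  - by have := h x (or_introl (or_introl erefl)) => /(Ranti _ _ xy) ->.
  - have zy := h y (or_introl (or_intror erefl)).
    by rewrite -(Ranti _ _ yz zy).
pose lt0 x y := R x y /\ x <> y.
have lt0P x y : [\/ lt0 x y, x = y | lt0 y x].
  have [->|xy] := pselect (x = y); first by constructor 2.
  have [h|h] := Rtot x y; [constructor 1|constructor 3] => //; split=> //.
  exact: nesym.
have lt0tr x y z : lt0 x y -> lt0 y z -> lt0 x z.
  move=> [xy nxy] [yz nyz]; split; first exact: Rtr yz.
  by move=> xz; apply: nxy; apply: Ranti => //; rewrite xz.
have lt0wf : well_founded lt0.
  move=> x; apply: contrapT => nx.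
  have [|z nz zm] := Rmin [set x | ~ Acc lt0 x]; first by exists x.
  apply: nz; constructor=> y [yz nyz]; apply: contrapT => /zm zy.
  by apply: nyz; exact: Ranti.
have [h|/existsNP/Rmin[x /contrapT [j jI] xm]] :=
    pselect (forall x, ~ embeds T {y | lt0 y x}).
  by exists lt0.
pose i t := sval (j t).
have iI : injective i by move=> s t st; apply: jI; exact: sval_inj.
exists (fun s t => lt0 (i s) (i t)); split.
- move=> t; move: {2}(i t) (erefl (i t)) => u; elim/(well_founded_ind lt0wf): u t.
  by move=> u IH t tu; constructor=> s st; apply: IH; [rewrite -tu; exact: st|].
- by move=> s t u; exact: lt0tr.
- move=> s t; have [h|/iI h|h] := lt0P (i s) (i t);
    by [constructor 1|constructor 2|constructor 3].
- move=> t [k kI]; have [tx ntx] := svalP (j t).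
  suff /xm xt : ~ ~ embeds T {y | lt0 y (i t)}.
    by apply: ntx; exact: Ranti.
  apply; exists (fun s =>
    exist (fun y => lt0 y (i t)) (i (sval (k s))) (svalP (k s))).
  by move=> s s' /(congr1 sval) /= /iI ?; exact/kI/sval_inj.
Qed.

(** * Pseudo-intersections in a G-delta semifilter *)

Lemma finite_nat_bound (A : set nat) : finite_set A -> exists k, A `<=` `I_k.
Proof.
move=> /finite_seqP[s ->]; exists (\max_(i <- s) i).+1 => n /= ns.
by rewrite ltnS; apply: (@leq_bigmax_seq _ s predT id).
Qed.

Lemma subset_almost A B : A `<=` B -> A `<=*` B.
Proof.
by move=> AB; apply: (sub_finite_set (B := set0)) => // x [/AB].
Qed.

Lemma almost_trans B A C : A `<=*` B -> B `<=*` C -> A `<=*` C.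
Proof.
move=> AB BC; apply: (sub_finite_set (B := (A `\` B) `|` (B `\` C))).
  by move=> x [Ax nCx]; have [Bx|nBx] := pselect (B x); [right|left].
by rewrite finite_setU.
Qed.

Lemma almost_setI A A' B B' :
  A `<=*` A' -> B `<=*` B' -> A `&` B `<=*` A' `&` B'.
Proof.
move=> AB BC; apply: (sub_finite_set (B := (A `\` A') `|` (B `\` B'))).
  move=> x [[Ax Bx] nx]; have [Bx'|nBx] := pselect (A' x); [right|left] => //.
  by split=> // Bx''; apply: nx.
by rewrite finite_setU.
Qed.

(** If every cut failed, the counterexamples [x_ k] would cluster at a point [y] that contains all
    of [C]; the open set [U] contains [y] but none of the [x_ k]. *)
Lemma open_superset_bound (U : set cantor_space) (C : set nat) : open U ->
    (forall x : cantor_space, C `<=` [set n | x n] -> U x) ->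
  exists k, forall x : cantor_space, C `&` `I_k `<=` [set n | x n] -> U x.
Proof.
move=> oU CU; apply: contrapT => /forallNP nU.
have /choice[x_ xP] k : exists x : cantor_space,
    C `&` `I_k `<=` [set n | x n] /\ ~ U x.
  by have /existsNP[x /not_implyP[]] := nU k; exists x.
have [|y [_ xy]] := @cantor_space_compact (x_ @ \oo) _; first exact: filterT.
have Uy : U y.
  apply: CU => n Cn /=; apply/negPn/negP => yn.
  have ny : nbhs y [set x : cantor_space | x n = false].
    have /(_ [set false]) := @proj_continuous _ (fun _ : nat => bool) n y.
    by apply; rewrite /proj (negbTE yn); exact: discrete_set1.
  have xn : (x_ @ \oo) [set x : cantor_space | x n].
    exists n.+1 => //= k nk; apply: (xP k).1; split=> //=.
  by have [z [/= zn]] := xy _ _ xn ny; rewrite zn.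
have [||z [nUz Uz]] := xy (~` U) U; last exact: nUz.
  by exists 0 => // k _; exact: (xP k).2.
exact: open_nbhs_nbhs.
Qed.

(** The hypothesis on [phi] expresses that [I] has fewer than d elements; it is applied to the
    moduli [f]. *)
Lemma gdelta_pseudo_intersection (G : set (set nat)) (I : Type)
    (C : I -> set nat) (A : nat -> set nat) :
  almost_up_closed G -> Gdelta (in_cantor G) ->
  (forall phi : I -> nat -> nat, ~ dominating (range phi)) ->
  (forall m n, m <= n -> A n `<=` A m) -> (forall i n, G (C i `&` A n)) ->
  exists X, (forall n, X `<=*` A n) /\ forall i, G (X `&` C i).
Proof.
move=> Gup [F oF GF] nd Adec CAG.
have GFP (x : cantor_space) : G [set n | x n] <-> forall m, F m x.
  have -> : G [set n | x n] = in_cantor G x by [].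
  by rewrite GF; split=> [h m|h m _]; exact: h.
(* [f i n] coordinates of [C i `&` A n] suffice to enter the first [n.+1] of
   the open sets whose intersection is [G]. *)
have /choice[f fP] i : exists f : nat -> nat, forall n m, m <= n ->
    forall x : cantor_space,
      C i `&` A n `&` `I_(f n) `<=` [set n | x n] -> F m x.
  suff : forall n, exists k, forall m, m <= n -> forall x : cantor_space,
      C i `&` A n `&` `I_k `<=` [set n | x n] -> F m x.
    by move=> /choice[f fP]; exists f.
  move=> n.
  have /choice[k kP] m : exists k, forall x : cantor_space,
      C i `&` A n `&` `I_k `<=` [set n | x n] -> F m x.
    apply: open_superset_bound => // x CAx; apply: (GFP x).1.
    by apply: Gup (CAG i n) _; exact: subset_almost.
  exists (\max_(m < n.+1) k m) => m mn x h; apply: kP => j [CAj /= jk].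
  apply: h; split=> //=; apply: (leq_trans jk).
  exact: (@leq_bigmax _ (fun m : 'I_n.+1 => k m) (Ordinal (mn : m < n.+1))).
have /existsNP[g gP] := nd f.
pose X := \bigcup_n (A n `&` `I_(g n)).
exists X; split=> [n|i].
  apply: sub_finite_set (finite_II (\max_(m < n) g m)) => j [[m _ [Aj jg]] nAj].
  have mn : m < n by rewrite ltnNge; apply/negP => /Adec/(_ _ Aj).
  apply: (leq_trans jg).
  exact: (@leq_bigmax _ (fun m : 'I_n => g m) (Ordinal mn)).
(* Otherwise [f i] would bound [g] from [m] on, against the choice of [g]. *)
have infg m : exists2 n, m <= n & f i n <= g n.
  apply: contrapT => nm; apply: gP; exists (f i); first by exists i.
  apply: sub_finite_set (finite_II m) => n /negP; rewrite -ltnNge => /ltnW gn /=.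
  by rewrite ltnNge; apply/negP => mn; apply: nm; exists n.
have XE : X `&` C i = [set n | (fun n => `[< (X `&` C i) n >]) n].
  by apply/seteqP; split=> n /asboolP.
(* Since [f i n <= g n], the block of [X] at [n] holds all the coordinates that put the trace of [X]
   on [C i] into [F m]. *)
rewrite XE; apply/GFP => m; have [n mn fg] := infg m.
apply: (fP i n m mn) => j [[Cj Aj] /= jf]; apply/asboolP; split=> //.
by exists n => //; split=> //=; exact: leq_trans fg.
Qed.

(** * Stone duals and P-filters *)

(** Freeness gives, for each [k], a member that misses [k]; so an initial segment is removed point
    by point. *)
Lemma star_cofinite (p : omega_star) (A : set nat) :
  finite_set A -> star_sets p (~` A).
Proof.
move=> /finite_nat_bound[k Ak]; have pU := star_ultra p.
suff pk : star_sets p (~` `I_k) by apply: filterS pk => n nk /Ak.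
elim: k {Ak} => [|k IH].
  by apply: filterS (@filterT _ (star_sets p) _) => n _.
have [Y pY nY] : exists2 Y, star_sets p Y & ~ Y k.
  apply: contrapT => nY; suff : (\bigcap_(A in star_sets p) A) k.
    by rewrite star_free.
  by move=> Y pY; apply: contrapT => nYk; apply: nY; exists Y.
apply: filterS (filterI IH pY) => n [/= nk Yn]; rewrite ltnS leq_eqVlt.
by move=> /orP[/eqP nk'|//]; apply: nY; rewrite -nk'.
Qed.

Lemma star_almost A B : A `<=*` B -> star A `<=` star B.
Proof.
move=> AB p pA; have pU := star_ultra p.
apply: filterS (filterI (star_cofinite p AB) pA) => n [nAB An].
by apply: contrapT => nBn; apply: nAB.
Qed.

Lemma starU A B : star (A `|` B) `<=` star A `|` star B.
Proof.
move=> p pAB; have pU := star_ultra p.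
have [|pA] := in_ultra_setVsetC A pU; [by left|right].
by apply: filterS (filterI pA pAB) => n [nA []].
Qed.

Lemma star_open A : open (star A).
Proof. by exists [set A] => //; rewrite bigcup_set1. Qed.

Lemma open_star_base (V : set omega_star) p : open V -> V p ->
  exists2 A, star A p & star A `<=` V.
Proof.
move=> [D _ <-] [A DA pA]; exists A => // q qA; by exists A.
Qed.

(** Compactness in terms of filters. If no [star A] with [A] in [F] fits in [V], the differences of
    a member of [F] and a set [X] with [star X] inside [V] generate a proper filter; a free
    ultrafilter above it lies in the dual, hence in [V], yet contains the complement of every such
    [X]. *)
Lemma stone_dual_open (F : set (set nat)) (V : set omega_star) :
  F !=set0 -> (forall A, F A -> ~ finite_set A) ->
  (forall A B, F A -> F B -> F (A `&` B)) ->
  open V -> stone_dual F `<=` V -> exists2 A, F A & star A `<=` V.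
Proof.
move=> [A0 FA0] Fninf FI oV FV; apply: contrapT => nA.
pose H := [set Y | exists A X, [/\ F A, star X `<=` V & A `\` X `<=*` Y]].
have star0V : star set0 `<=` V.
  by move=> p p0; have pU := star_ultra p;
    have [] := @filter_not_empty _ (star_sets p) _.
have HF A : F A -> H A.
  by move=> FA; exists A, set0; split=> //; apply: subset_almost => n [].
have PH : ProperFilter H.
  apply: Build_ProperFilter.
    move=> [A [X [FA XV]]]; rewrite /almost_subset setD0 => AX.
    by apply: nA; exists A => // p /(star_almost AX)/XV.
  split.
  - by exists A0, set0; split=> //; exact: subset_almost.
  - move=> Y Y' [A [X [FA XV AX]]] [A' [X' [FA' XV' AX']]].
    exists (A `&` A'), (X `|` X'); split.
    - exact: FI.
    - by move=> p /starU[/XV|/XV'].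
    - apply: almost_trans (almost_setI AX AX'); apply: subset_almost.
      move=> n [[An An'] nX]; split; split=> // ?; apply: nX; [by left|by right].
  - move=> Y Y' YY' [A [X [FA XV AX]]]; exists A, X; split=> //.
    by apply: almost_trans AX _; exact: subset_almost.
have [p [pU Hp]] := ultraFilterLemma PH.
have pfree : \bigcap_(A in p) A = set0.
  apply/seteqP; split=> // n /(_ (~` [set n])) h; apply: h => //.
  apply: Hp; exists A0, set0; split=> //.
  by apply: sub_finite_set (finite_set1 n) => m [_ /contrapT].
have Vq : V (OmegaStar pU pfree) by apply: FV => A /HF/Hp.
have [X pX XV] := open_star_base oV Vq.
have : p (X `&` ~` X).
  apply: filterI; first exact: pX.
  by apply: Hp; exists A0, X; split=> //; apply: subset_almost => n [].
by rewrite setICr; exact: filter_not_empty.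
Qed.

(** * Filters and ultrafilters on a fixed semifilter *)

Section semifilter.
Variable G : set (set nat).
Hypothesis hG : semifilter G.

Lemma semifilter_sub A B : A `<=` B -> G A -> G B.
Proof. by case: hG => _ _ up AB GA; apply: up GA _; exact: subset_almost. Qed.

Lemma semisemifilter_filterT : G setT.
Proof. by case: hG => -[A GA] _ _; exact: semifilter_sub GA. Qed.

Lemma semifilter_infinite A : G A -> ~ finite_set A.
Proof.
case: hG => _ GT up GA fA; apply: GT; apply/seteqP; split=> // B _.
by apply: up GA _; apply: sub_finite_set fA => n [].
Qed.

(** Each [U n] contains the star of some [s n] in [F]; the star of a pseudo-intersection in [F] is
    then an open set between the dual and every [U n]. *)
Lemma P_filterP F : semifilter_filter G F ->
  (forall s : nat -> set nat, (forall n, F (s n)) ->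
    exists2 X, F X & forall n, X `<=*` s n) ->
  P_filter F.
Proof.
move=> [F0 FG Fup FI] Fs U oU FU p Fp.
have /choice[s sP] n : exists A, F A /\ star A `<=` U n.
  have [A] := stone_dual_open F0 (fun A FA => semifilter_infinite (FG _ FA))
    FI (oU n) (FU n).
  by exists A.
have [X FX Xs] := Fs s (fun n => (sP n).1).
suff : star X `<=` (\bigcap_n U n)° by apply; exact: Fp.
rewrite -open_subsetE; last exact: star_open.
by move=> q qX n _; apply/(sP n).2/(star_almost (Xs n)).
Qed.

(** The traces of [X] on the members of [U] generate a filter on [G] above [U]; it equals [U] by
    maximality and contains [X]. *)
Lemma ultrafilter_mem U X : semifilter_ultrafilter G U ->
  (forall C, U C -> G (X `&` C)) -> U X.
Proof.
move=> [[[A UA] UG Uup UI] Umax] XU.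
pose H := [set Y | exists2 C, U C & X `&` C `<=*` Y].
suff <- : H = U by exists A => //; apply: subset_almost => n [].
apply: Umax; last by move=> C UC; exists C => //; apply: subset_almost => n [].
have [_ _ Gup] := hG; split.
- by exists A, A => //; apply: subset_almost => n [].
- by move=> Y [C /XU GXC]; exact: Gup.
- by move=> Y Z [C UC CY] YZ; exists C => //; exact: almost_trans YZ.
- move=> Y Z [C UC CY] [D UD DZ]; exists (C `&` D); first exact: UI.
  apply: almost_trans (almost_setI CY DZ); apply: subset_almost.
  by move=> n [Xn [Cn Dn]].
Qed.

Lemma semifilter_filterT F : semifilter_filter G F -> F setT.
Proof. by case=> -[A FA] _ up _; apply: up FA _; exact: subset_almost. Qed.

End semifilter.

(** * Transfinite construction *)

(** Turns any sequence into a decreasing one with the same pseudo-intersections. *)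
Fixpoint prefix_cap (s : nat -> set nat) n : set nat :=
  if n is m.+1 then prefix_cap s m `&` s n else s 0.

Lemma prefix_cap_le s m n : m <= n -> prefix_cap s n `<=` prefix_cap s m.
Proof.
elim: n => [|n IH]; first by rewrite leqn0 => /eqP ->.
by rewrite leq_eqVlt => /orP[/eqP -> //|/IH nm] j [/nm].
Qed.

Lemma prefix_cap_sub s n : prefix_cap s n `<=` s n.
Proof. by case: n => [|n] // j []. Qed.

Lemma prefix_cap_ind (P : set nat -> Prop) s :
  (forall A B, P A -> P B -> P (A `&` B)) -> (forall n, P (s n)) ->
  forall n, P (prefix_cap s n).
Proof. by move=> PI Ps; elim=> //= n IH; apply: PI. Qed.

(** The inclusion of [fin_cap E] in [G] is the compatibility test below: it says that [E] generates
    a filter on [G]. *)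
Inductive fin_cap (E : set (set nat)) : set nat -> Prop :=
| fin_capT : fin_cap E setT
| fin_cap_cons X Y : E X -> fin_cap E Y -> fin_cap E (X `&` Y).

Lemma fin_cap1 E X : E X -> fin_cap E X.
Proof.
by move=> EX; rewrite -(setIT X); apply: fin_cap_cons => //; exact: fin_capT.
Qed.

Lemma fin_capI E X Y : fin_cap E X -> fin_cap E Y -> fin_cap E (X `&` Y).
Proof.
elim=> [|X1 X2 EX1 _ IH] EY; first by rewrite setTI.
by rewrite -setIA; apply: fin_cap_cons => //; exact: IH.
Qed.

Lemma fin_cap_sub E E' X : E `<=` E' -> fin_cap E X -> fin_cap E' X.
Proof.
by move=> EE'; elim=> [|X1 X2 /EE' EX1 _]; [exact: fin_capT|exact: fin_cap_cons].
Qed.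

Lemma fin_capU1 E A X : fin_cap (E `|` [set A]) X ->
  exists2 Y, fin_cap E Y & A `&` Y `<=` X.
Proof.
elim=> [|X1 X2 EX1 _ [Y EY YX]]; first by exists setT => //; exact: fin_capT.
case: EX1 => [EX1|->].
  exists (X1 `&` Y); first exact: fin_cap_cons.
  by move=> n [An [X1n Yn]]; split=> //; exact: YX.
by exists Y => // n [An Yn]; split=> //; exact: YX.
Qed.

Lemma fin_cap_range K (gen : K -> set nat) X : fin_cap (range gen) X ->
  exists l : seq K, X = foldr (fun k => setI (gen k)) setT l.
Proof.
elim=> [|X1 X2 [k _ <-] _ [l ->]]; first by exists [::].
by exists (k :: l).
Qed.

Lemma range_fin_cap K (gen : K -> set nat) (l : seq K) :
  fin_cap (range gen) (foldr (fun k => setI (gen k)) setT l).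
Proof.
by elim: l => [|k l IH] /=; [exact: fin_capT|apply: fin_cap_cons => //; exists k].
Qed.

Lemma filter_fin_cap G F E X : semifilter_filter G F -> E `<=` F ->
  fin_cap E X -> F X.
Proof.
move=> FF EF; elim=> [|X1 X2 /EF ? _ ?]; first exact: semifilter_filterT FF.
by case: FF => _ _ _; apply.
Qed.

(** A dominating range would have at least d = c elements, and so would [K]. *)
Lemma d_eq_c_not_dominating K (phi : K -> nat -> nat) : d_eq_c ->
  ~ embeds (set nat) K -> ~ dominating (range phi).
Proof.
move=> [_ dc] nK /dc cr; apply: nK.
have [f fI] := card_le_embeds (card_le_trans cr (card_image_le phi setT)).
exists (fun x => val (f (SigSub (mem_set (I : [set: set nat] x))))).
by move=> x y /val_inj/fI/(congr1 val).
Qed.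

Section construction.
Variable G : set (set nat).
Hypothesis hG : semifilter G.
Hypothesis hGd : Gdelta (in_cantor G).
Hypothesis dc : d_eq_c.

(** The diagonal lemma is applied to the prefixes of [s] and to the finite intersections of [gen].
    The latter are indexed by [seq K], which embeds in the infinite type [K], so there are fewer
    than d = c of them. *)
Lemma fin_cap_pseudo_intersection K (gen : K -> set nat) (s : nat -> set nat) :
  embeds nat K -> ~ embeds (set nat) K ->
  fin_cap (range gen `|` range s) `<=` G ->
  exists X, (forall n, X `<=*` s n) /\ fin_cap (range gen `|` [set X]) `<=` G.
Proof.
move=> nK cK sG; have [_ _ Gup] := hG.
have [|||X [Xs XG]] := @gdelta_pseudo_intersection G (seq K)
    (foldr (fun k => setI (gen k)) setT) (prefix_cap s) Gup hGd.
- move=> phi; apply: d_eq_c_not_dominating => // cK'.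
  by apply: cK; apply: embeds_trans (embeds_seq nK).
- exact: prefix_cap_le.
- move=> l n; apply: sG; apply: fin_capI.
    by apply: fin_cap_sub (range_fin_cap gen l) => A; left.
  apply: prefix_cap_ind => [A B|m]; first exact: fin_capI.
  by apply: fin_cap1; right; exists m.
exists X; split=> [n|Y /fin_capU1[Z /fin_cap_range[l ->]]].
  by apply: almost_trans (Xs n) _; apply: subset_almost; exact: prefix_cap_sub.
by move=> XlY; apply: semifilter_sub XlY _.
Qed.

(** A sequence compatible with the final [E] is compatible with the part present at its own stage.
    That part has fewer than c sets, so a suitable pseudo-intersection was available and was added
    then. *)
Lemma generic_extension K (gen : K -> set nat) :
  embeds nat K -> ~ embeds (set nat) K -> fin_cap (range gen) `<=` G ->
  exists E, [/\ range gen `<=` E, fin_cap E `<=` G &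
    forall s : nat -> set nat, fin_cap (E `|` range s) `<=` G ->
      exists2 X, E X & forall n, X `<=*` s n].
Proof.
move=> nK cK genG.
have [lt [ltwf lttr lttot ltseg]] := initial_order_exists (set nat : eqType).
(* Subsets of [nat] code the sequences of subsets of [nat]. *)
pose seq_of (i : set nat) (n : nat) := [set k : nat | i (choice.pickle (n, k))].
have seq_of_onto (s : nat -> set nat) : exists i, seq_of i = s.
  exists [set m | exists n k : nat, m = choice.pickle (n, k) /\ s n k].
  apply/funext => n; apply/seteqP; split=> [k [n' [k' []]]|k snk].
    by move=> /(pcan_inj choice.pickleK)[-> ->].
  by exists n, k.
pose good E i X :=
  (forall n, X `<=*` seq_of i n) /\ fin_cap (E `|` [set X]) `<=` G.
(* The default [setT] adds no constraint when no good set exists. *)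
pose step i (prev : forall j, lt j i -> set nat) : set nat :=
  xget setT (good (range gen `|` [set X | exists j h, X = prev j h]) i).
pose A := Fix ltwf (fun _ => set nat) step.
pose E (J : set (set nat)) := range gen `|` A @` J.
have AE i : A i = xget setT (good (E [set j | lt j i]) i).
  rewrite /A Fix_eq; last first.
    move=> j f g fg; rewrite /step; congr (xget _ (good (_ `|` _) _)).
    by apply/seteqP; split=> X [k [h ->]]; exists k, h.
  rewrite /step; congr (xget _ (good (_ `|` _) _)).
  by apply/seteqP; split=> [X [j [h ->]]|_ [j h <-]]; exists j.
(* A finite intersection uses finitely many stages, so it is already formed at the last of them.
   Initial segments [J] drive the induction, and [J = setT] gives the result. *)
have EJ (J : set (set nat)) :
    (forall j, J j -> fin_cap (E [set k | lt k j] `|` [set A j]) `<=` G) ->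
    fin_cap (E J) `<=` G.
  move=> JG X EX.
  suff [/genG//|[j Jj /(JG _ Jj)//]] : fin_cap (range gen) X \/
      exists2 j, J j & fin_cap (E [set k | lt k j] `|` [set A j]) X.
  have le_sub j k : lt j k \/ j = k -> E [set l | lt l j] `|` [set A j] `<=`
      E [set l | lt l k] `|` [set A k].
    move=> [jk|->//] Y [[gY|[l lj <-]]|->].
    - by left; left.
    - by left; right; exists l => //; exact: lttr jk.
    - by left; right; exists j.
  elim: EX => [|X1 X2 EX1 _ IH]; first by left; exact: fin_capT.
  case: EX1 => [gX1|[j Jj AX1]].
    case: IH => [gX2|[k Jk gX2]]; first by left; exact: fin_cap_cons.
    by right; exists k => //; apply: fin_cap_cons => //; left; left.
  rewrite -AX1 {X1 AX1}; right.
  case: IH => [gX2|[k Jk gX2]].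
    exists j => //; apply: fin_cap_cons; first by right.
    by apply: fin_cap_sub gX2 => Y gY; left; left.
  have [l Jl [jl kl]] : exists2 l, J l & (lt j l \/ j = l) /\ (lt k l \/ k = l).
    have [jk|jk|kj] := lttot j k; first by exists k => //; split; [left|right].
      by exists k => //; split; right.
    by exists j => //; split; [right|left].
  exists l => //; apply: fin_cap_cons; first by apply: (le_sub _ _ jl); right.
  exact: fin_cap_sub (le_sub _ _ kl) gX2.
have AG i : fin_cap (E [set j | lt j i] `|` [set A i]) `<=` G.
  elim/(well_founded_ind ltwf): i => i /EJ EiG.
  have [[X gX]|/forallNP nX] := pselect (exists X, good (E [set j | lt j i]) i X).
    by rewrite AE; have [] := xgetPex setT (ex_intro _ X gX).
  rewrite AE xgetPN// => Y /fin_capU1[Z /EiG GZ].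
  by rewrite setTI => ZY; exact: semifilter_sub ZY GZ.
exists (E setT); split=> [X gX|X|s sG]; [by left|by apply: EJ|].
have [i si] := seq_of_onto s.
exists (A i); first by right; exists i.
suff [X gX] : exists X, good (E [set j | lt j i]) i X.
  by rewrite AE -si; have [] := xgetPex setT (ex_intro _ X gX).
pose gen' (k : K + {j | lt j i}) :=
  match k with inl k => gen k | inr j => A (sval j) end.
have gen'E : range gen' = E [set j | lt j i].
  apply/seteqP; split=> [_ [[k|[j ji]] _ <-]|_ [[k _ <-]|[j ji <-]]].
  - by left; exists k.
  - by right; exists j.
  - by exists (inl k).
  - by exists (inr (exist _ j ji)).
have [|||X] := @fin_cap_pseudo_intersection _ gen' s.
- by apply: embeds_trans nK _; exists inl => x y [].
- exact: not_embeds_sum (ltseg i).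
- move=> X sX; apply: sG; apply: fin_cap_sub sX.
  rewrite gen'E => Y [[gY|[j ji <-]]|sY]; [by left; left| |by right].
  by left; right; exists j.
- by rewrite gen'E -si => XG; exists X.
Qed.

Lemma P_ultrafilter_extension F : semifilter_filter G F ->
  (exists B, generated_by F B /\ card_lt_c B) ->
  exists U, [/\ semifilter_ultrafilter G U, P_filter U & F `<=` U].
Proof.
move=> hF [B [[BF FE] [_ cB]]]; have [_ _ Gup] := hG.
(* The summand [nat] makes the index type infinite and contributes only [setT]. *)
pose gen (k : nat + B) := match k with inl _ => setT | inr X => val X end.
have genF : range gen `<=` F.
  move=> _ [[n|X] _ <-] /=; first exact: semifilter_filterT hF.
  by apply: BF; apply: set_mem; exact: valP.
have [|||E [genE EG Es]] := @generic_extension _ gen.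
- by exists inl => x y [].
- apply: not_embeds_sum; [exact: embeds_refl|exact: cantor_nat|].
  move=> [f fI]; apply: cB.
  have fI' : {in [set: set nat] &, injective (val \o f)}.
    by move=> x y _ _ /val_inj/fI.
  rewrite -(card_le_eql (inj_card_eq fI')).
  by apply: subset_card_le => _ [x _ <-]; apply: set_mem; exact: valP.
- move=> X /(filter_fin_cap hF genF) FX.
  by case: hF => _ FG _ _; exact: FG.
pose U := [set Y | exists2 X, fin_cap E X & X `<=*` Y].
have EU : E `<=` U.
  by move=> X EX; exists X; [exact: fin_cap1|exact: subset_almost].
have UF : semifilter_filter G U.
  split.
  - by exists setT, setT; [exact: fin_capT|exact: subset_almost].
  - by move=> Y [X /EG GX]; exact: Gup.
  - by move=> Y Z [X EX XY] YZ; exists X => //; exact: almost_trans YZ.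
  - move=> Y Z [X EX XY] [X' EX' XZ]; exists (X `&` X'); first exact: fin_capI.
    exact: almost_setI.
(* For [H = U] this gives the P-property; for a larger [H] and a constant sequence it gives
   maximality. Compatibility holds because all the sets involved lie in [H]. *)
have cap_in H (s : nat -> set nat) :
    semifilter_filter G H -> U `<=` H -> (forall n, H (s n)) ->
    exists2 X, U X & forall n, X `<=*` s n.
  move=> HF UH Hs; have [X sX|X EX Xs] := Es s; last by exists X => //; exact: EU.
  have HX : H X by apply: filter_fin_cap HF _ sX => Y [/EU/UH//|[n _ <-]].
  by case: HF => _ HG _ _; exact: HG.
exists U; split.
- split=> // H HF UH; apply/seteqP; split=> // Y HY.
  have [X UX XY] := cap_in _ (fun=> Y) HF UH (fun=> HY).
  by case: UF => _ _ Uup _; apply: Uup UX (XY 0).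
- by apply: (P_filterP hG UF) => s; exact: cap_in.
- rewrite FE => Y [C BC CY]; exists C => //; apply/fin_cap1/genE.
  by exists (inr (SigSub (mem_set BC))).
Qed.

End construction.

Theorem theorem4p3 (G : set (set nat)) (hG : semifilter G)
    (hGd : Gdelta (in_cantor G)) :
  [/\ d_eq_c -> exists U, semifilter_ultrafilter G U /\ P_filter U,
      d_eq_c -> forall F, semifilter_filter G F ->
        (exists B, generated_by F B /\ card_lt_c B) ->
        exists U, [/\ semifilter_ultrafilter G U, P_filter U & F `<=` U]
    & forall U, semifilter_ultrafilter G U ->
        (exists B, generated_by U B /\ card_lt_d B) -> P_filter U].
Proof.
have [_ _ Gup] := hG.
split=> [dc|dc F|U hU [B [[BU UE] dB]]].
(* The first claim is the second one for the filter of cofinite sets, generated by [setT] alone. *)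
- pose F := [set Y : set nat | setT `<=*` Y].
  have [||U [Uu UP _]] := @P_ultrafilter_extension _ hG hGd dc F; last by exists U.
  + split.
    * by exists setT; exact: subset_almost.
    * by move=> Y; exact: Gup (semisemifilter_filterT hG).
    * by move=> Y Z; exact: almost_trans.
    * by move=> Y Z FY FZ; have := almost_setI FY FZ; rewrite setTI.
  + exists [set setT]; split; first split.
    * by move=> _ ->; exact: subset_almost.
    * by apply/seteqP; split=> [Y FY|Y [_ ->]] //; exists setT.
    * split; first by apply/pcard_injP; exists id => x y _ _.
      move=> /card_le_trans/(_ (finite_set_countable (finite_set1 _)))/pcard_injP.
      by move=> [f fI]; apply: cantor_nat; exists f => x y; apply: fI; rewrite inE.
- exact: P_ultrafilter_extension.
- have [UF Umax] := hU; have [_ UG _ UI] := UF.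
  apply: (P_filterP hG UF) => s Us.
  have [phi dom| | i n|X [Xs XG]] := @gdelta_pseudo_intersection G B val
      (prefix_cap s) Gup hGd.
  + have [_ []] := dB _ dom.
    by rewrite -(card_le_eqr (card_setT B)); exact: card_image_le.
  + exact: prefix_cap_le.
  + apply: UG; apply: (UI); first by apply: BU; apply: set_mem; exact: valP.
    exact: (prefix_cap_ind UI Us).
  exists X.
    (* Each member of [U] almost contains a generator, so the traces of [X] on the generators
       suffice. *)
    apply: (ultrafilter_mem hG hU) => C; rewrite UE => -[D BD DC].
    apply: Gup (XG (SigSub (mem_set BD))) _.
    by apply: almost_setI => //; exact: subset_almost.
  move=> n; apply: almost_trans (Xs n) _; apply: subset_almost.
  exact: prefix_cap_sub.
Qed.
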